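(* Let $\Xi_P\subset\mathbb{R}^{n_0}$ be a compact convex set with non-empty interior and let $\omega^{(1)},\dots,\omega^{(n_0+1)}\in\mathbb{R}^{n_0}$ be affinely independent points with convex hull the simplex $S$. Let $\sigma^*$ be the smallest scaling factor $\sigma$ such that some translate of $\sigma S$ contains $\Xi_P$, and let $t^*$ be the corresponding translation vector, so that $\Xi_P\subseteq\sigma^*S+t^*$. Then $$t^*=\sum_{i=1}^{n_0+1}z_i\,\omega^{(i)}\qquad\text{and}\qquad\sigma^*=-\sum_{i=1}^{n_0+1}z_i,$$ where, for each $i=1,\dots,n_0+1$, $z_i=\min\big\{\sum_{j=1}^{n_0}l_{ij}x_j:\ x\in\Xi_P\big\}$.
   Context: $D$ is the invertible $(n_0+1)\times(n_0+1)$ matrix whose $i$-th column is $\omega^{(i)}$ followed by a final entry equal to $1$, and $l_{ij}$ ($1\le i,j\le n_0+1$) denote the entries of $D^{-1}$. Thus the barycentric coordinates of $x\in\mathbb{R}^{n_0}$ with respect to $\omega^{(1)},\dots,\omega^{(n_0+1)}$ are $\lambda_i(x)=\sum_{j=1}^{n_0}l_{ij}x_j+l_{i(n_0+1)}$. For $\sigma>0$ and $t\in\mathbb{R}^{n_0}$, $\sigma S+t=\{\sigma s+t:s\in S\}$. *)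

(* Defs.v *)
From mathcomp Require Import all_boot all_order all_algebra.
From mathcomp Require Import all_classical all_reals all_analysis.
Import Order.TTheory GRing.Theory Num.Theory.
Import numFieldNormedType.Exports.

Set Implicit Arguments.
Unset Strict Implicit.
Unset Printing Implicit Defensive.

Local Open Scope classical_set_scope.
Local Open Scope ring_scope.

Definition affinely_independent (R : realType) (V : lmodType R) (I : finType)
    (w : I -> V) : Prop :=
  forall c : I -> R,
    \sum_i c i = 0 -> \sum_i c i *: w i = 0 -> forall i, c i = 0.

Definition conv_hull (R : realType) (V : lmodType R) (I : finType)
    (w : I -> V) : set V :=
  [set x | exists c : I -> R,
    [/\ forall i, 0 <= c i, \sum_i c i = 1 & x = \sum_i c i *: w i]].

Definition scale_translate (R : realType) (V : lmodType R)
    (sigma : R) (t : V) (S : set V) : set V :=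
  [set sigma *: s + t | s in S].

Definition is_minimum (R : realType) (A : set R) (m : R) : Prop :=
  A m /\ lbound A m.

Definition covering_factors (R : realType) (V : lmodType R) (S Xi : set V) :
    set R :=
  [set sigma | 0 < sigma /\ exists t, Xi `<=` scale_translate sigma t S].

(* The size is n + 1 rather than n.+1 so that col_mx applies: lshift 1 j is the
   j-th coordinate index, and the last index is that of the row of ones. *)
Definition vertex_mx (R : realType) (n : nat) (w : 'I_(n + 1) -> 'cV[R]_n) :
    'M[R]_(n + 1) :=
  col_mx (\matrix_(j < n, i < n + 1) w i j 0) (const_mx 1).

(* The barycentric coordinate of x at w i, without its constant term. *)
Definition bary_lin (R : realType) (n : nat) (w : 'I_(n + 1) -> 'cV[R]_n)
    (i : 'I_(n + 1)) (x : 'cV[R]_n) : R :=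
  \sum_(j < n) invmx (vertex_mx w) i (lshift 1 j) * x j 0.

(* Main.v *)
(* Write [L_i] for the linear part of the i-th barycentric coordinate and [l_i]
   for its constant term.  For [sigma > 0], a point [x] lies in [sigma S + t] iff
   [L_i t - sigma l_i <= L_i x] for all i, so [sigma S + t] contains [Xi] iff
   [L_i t - sigma l_i <= z_i] for all i.  Summing over i, where [sum_i L_i = 0]
   and [sum_i l_i = 1], gives [- sum_i z_i <= sigma]; equality forces
   [z_i = L_i t - sigma l_i] for every i, and then
   [sum_i z_i omega_i = t] since [sum_i L_i(t) omega_i = t] and
   [sum_i l_i omega_i = 0]. *)
Require Import Defs.
From mathcomp Require Import all_boot all_order all_algebra.
From mathcomp Require Import all_classical all_reals all_analysis.
From mathcomp Require Import ring lra.
Import Order.TTheory GRing.Theory Num.Theory.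
Import numFieldNormedType.Exports.

Set Implicit Arguments.
Unset Strict Implicit.
Unset Printing Implicit Defensive.

Local Open Scope classical_set_scope.
Local Open Scope ring_scope.

(** The last column of the inverse pairs with the row of ones, hence the index [rshift n 0]. *)
Definition bary_const (R : realType) (n : nat) (w : 'I_(n + 1) -> 'cV[R]_n)
    (i : 'I_(n + 1)) : R :=
  invmx (vertex_mx w) i (rshift n 0).

Section Barycentric.
Variables (R : realType) (n : nat) (w : 'I_(n + 1) -> 'cV[R]_n).
Implicit Types (x t : 'cV[R]_n) (c : 'I_(n + 1) -> R).

Local Notation L := (bary_lin w).
Local Notation l := (bary_const w).

Lemma vertex_mx_mul (c : 'cV[R]_(n + 1)) :
  vertex_mx w *m c =
  col_mx (\sum_i c i 0 *: w i) (const_mx (\sum_i c i 0)).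
Proof.
rewrite /vertex_mx mul_col_mx; congr col_mx; apply/matrixP => i j.
  rewrite (ord1 j) !mxE summxE; apply: eq_bigr => k _.
  by rewrite !mxE mulrC.
rewrite (ord1 j) !mxE; apply: eq_bigr => k _.
by rewrite !mxE mul1r.
Qed.

Lemma invmx_vertex_mul x (a : R) i :
  (invmx (vertex_mx w) *m col_mx x (const_mx a)) i 0 = L i x + a * l i.
Proof.
rewrite mxE big_split_ord /= big_ord1 /bary_lin /bary_const; congr (_ + _).
  by apply: eq_bigr => j _; rewrite col_mxEu.
by rewrite col_mxEd mxE mulrC.
Qed.

Lemma bary_linD i x t : L i (x + t) = L i x + L i t.
Proof.
by rewrite /bary_lin -big_split; apply: eq_bigr => j _; rewrite mxE mulrDr.
Qed.

Lemma bary_linZ i a x : L i (a *: x) = a * L i x.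
Proof.
by rewrite /bary_lin mulr_sumr; apply: eq_bigr => j _; rewrite mxE mulrCA.
Qed.

Lemma continuous_bary_lin i : continuous (L i).
Proof.
apply: (@continuous_big _ _ +%R 0).
  exact: (@add_continuous R^o).
move=> j _ x; apply: (@cvgM R _ (nbhs x) _ (fun=> _) (fun y => y j 0)).
  exact: cvg_cst.
exact: coord_continuous.
Qed.

Hypothesis w_indep : affinely_independent w.

(** A column killed by [vertex_mx w] is a family of coefficients with zero sum and zero combination
    of the [w i], which affine independence forces to vanish. Transposing turns this into a
    statement about a left kernel, the form that [kermx] handles. *)
Lemma vertex_mx_unit : vertex_mx w \in unitmx.
Proof.
rewrite -unitmx_tr -row_free_unit -kermx_eq0; apply/eqP/row_matrixP => k.
rewrite row0; set v := row k _.
have: v *m (vertex_mx w)^T = 0 by rewrite -row_mul mulmx_ker row0.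
move/(congr1 trmx); rewrite trmx_mul trmxK trmx0 vertex_mx_mul -col_mx0.
move=> /eq_col_mx[vw0 /matrixP/(_ 0 0)]; rewrite !mxE => v0.
by apply/rowP => i; have := w_indep v0 vw0 i; rewrite !mxE.
Qed.

(** Both equations are the blocks of [D *m (D^-1 *m y) = y] for [y] equal to [x] above [a]. Keeping
    [a] free lets [a = 0] isolate the linear parts and [x = 0], [a = 1] the constant terms. *)
Lemma vertex_mxV x (a : R) :
  \sum_i (L i x + a * l i) *: w i = x /\ \sum_i (L i x + a * l i) = a.
Proof.
have := mulKVmx vertex_mx_unit (col_mx x (const_mx a)).
rewrite vertex_mx_mul; under eq_bigr do rewrite invmx_vertex_mul.
under [in const_mx _]eq_bigr do rewrite invmx_vertex_mul.
by move=> /eq_col_mx[-> /matrixP/(_ 0 0)]; rewrite !mxE.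
Qed.

Lemma sum_bary_lin x : \sum_i L i x = 0.
Proof.
by have [_] := vertex_mxV x 0; under eq_bigr do rewrite mul0r addr0.
Qed.

Lemma bary_lin_vertices x : \sum_i L i x *: w i = x.
Proof.
by have [+ _] := vertex_mxV x 0; under eq_bigr do rewrite mul0r addr0.
Qed.

Lemma sum_bary_const : \sum_i l i = 1.
Proof.
have [_] := vertex_mxV 0 1; under eq_bigr do rewrite mul1r.
by rewrite big_split /= sum_bary_lin add0r.
Qed.

Lemma bary_const_vertices : \sum_i l i *: w i = 0.
Proof.
have [+ _] := vertex_mxV 0 1; under eq_bigr do rewrite mul1r scalerDl.
by rewrite big_split /= bary_lin_vertices add0r.
Qed.

(** This is row [i] of [D^-1 *m (D *m c) = c]. The sum of [c] is left arbitrary: it is 1 for points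
    of the simplex, but not for the minima [z]. *)
Lemma bary_lin_comb c i :
  L i (\sum_j c j *: w j) = c i - (\sum_j c j) * l i.
Proof.
apply/eqP; rewrite eq_sym subr_eq eq_sym -invmx_vertex_mul; apply/eqP.
have -> : col_mx (\sum_j c j *: w j) (const_mx (\sum_j c j)) =
    vertex_mx w *m \col_j c j.
  by rewrite vertex_mx_mul; congr (col_mx _ (const_mx _));
    apply: eq_bigr => j _; rewrite mxE.
by rewrite mulKmx ?vertex_mx_unit// mxE.
Qed.

Lemma scale_translate_conv_hullP (sigma : R) t x : 0 < sigma ->
  scale_translate sigma t (conv_hull w) x <->
  forall i, L i t - sigma * l i <= L i x.
Proof.
move=> s0; split=> [[_ [c [c0 c1 ->]] <-] i|H].
  rewrite bary_linD bary_linZ bary_lin_comb c1.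
  by have := mulr_ge0 (ltW s0) (c0 i); lra.
(* These are the barycentric coordinates of [(x - t) / sigma]; the hypothesis says exactly that they
   are nonnegative. *)
pose c i := (L i x - L i t) / sigma + l i.
have sE : \sum_i c i *: w i = sigma^-1 *: (x - t).
  under eq_bigr do rewrite scalerDl mulrC -scalerA scalerBl.
  rewrite big_split /= bary_const_vertices addr0 -scaler_sumr sumrB.
  by rewrite !bary_lin_vertices.
exists (\sum_i c i *: w i).
  exists c; split=> // [i|].
    rewrite /c -(@pmulr_rge0 _ sigma)// mulrDr mulrCA divff ?gt_eqF// mulr1.
    by have := H i; lra.
  by rewrite big_split /= -mulr_suml sumrB !sum_bary_lin subrr mul0r add0r
    sum_bary_const.
by rewrite sE scalerA divff ?gt_eqF// scale1r subrK.
Qed.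

End Barycentric.

(** Shifting every coordinate by half the radius stays in the ball, and one coordinate suffices to
    see that the point moved. Two distinct points of [Xi] will exclude a nonpositive scaling
    factor. *)
Lemma interior_cV_neq (R : realType) (n : nat) (A : set 'cV[R]_n) :
  (0 < n)%N -> interior A !=set0 -> exists x y, [/\ A x, A y & x != y].
Proof.
move=> n0 [x Ax]; have /nbhs_ballP[e /= e0 eA] := Ax.
exists x, (x + const_mx (e / 2)); split.
- exact: interior_subset.
- apply: eA; split=> // i j.
  by rewrite !mxE /ball /= opprD addNKr normrN gtr0_norm; lra.
- apply/eqP => /matrixP/(_ (Ordinal n0) 0); rewrite !mxE; lra.
Qed.

Theorem theorem4 (R : realType) (n0 : nat) (n0_gt0 : (0 < n0)%N)
    (Xi : set 'cV[R]_n0) (omega : 'I_(n0 + 1) -> 'cV[R]_n0)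
    (Xi_compact : compact Xi) (Xi_convex : convex_set Xi)
    (Xi_interior : interior Xi !=set0)
    (omega_indep : affinely_independent omega) :
  exists z : 'I_(n0 + 1) -> R,
    (forall i, is_minimum [set bary_lin omega i x | x in Xi] (z i)) /\
    (exists sigma t,
       is_minimum (covering_factors (conv_hull omega) Xi) sigma /\
       Xi `<=` scale_translate sigma t (conv_hull omega)) /\
    (forall sigma t,
       is_minimum (covering_factors (conv_hull omega) Xi) sigma ->
       Xi `<=` scale_translate sigma t (conv_hull omega) ->
       t = \sum_i z i *: omega i /\ sigma = - \sum_i z i).
Proof.
have [p [q [Xp Xq pq]]] := interior_cV_neq n0_gt0 Xi_interior.
have /choice[z zP] : forall i, exists m,
    is_minimum [set bary_lin omega i x | x in Xi] m.
  move=> i; have Xi0 : Xi !=set0 by exists p.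
  have [c cX cmin] := compact_EVT_min Xi0 Xi_compact
    (continuous_subspaceT (@continuous_bary_lin _ _ omega i)).
  exists (bary_lin omega i c); split; first by exists c => //; exact/set_mem.
  by move=> _ [x Xx <-]; apply: cmin; exact/mem_set.
have z_le i x : Xi x -> z i <= bary_lin omega i x.
  by move=> Xx; apply: (zP i).2; exists x.
have cover sigma t : 0 < sigma ->
    Xi `<=` scale_translate sigma t (conv_hull omega) <->
    forall i, bary_lin omega i t - sigma * bary_const omega i <= z i.
  move=> s0; split=> [XS i|H x Xx].
    (* The constraint at a minimiser of the i-th linear form is the strongest one. *)
    have [x Xx <-] := (zP i).1.
    by have /scale_translate_conv_hullP := XS x Xx; exact.
  apply/scale_translate_conv_hullP => // i.
  exact: le_trans (H i) (z_le _ _ Xx).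
have sum_bound sigma t :
    \sum_i (bary_lin omega i t - sigma * bary_const omega i) = - sigma.
  by rewrite sumrB sum_bary_lin// -mulr_sumr sum_bary_const// mulr1 sub0r.
have lb sigma : covering_factors (conv_hull omega) Xi sigma ->
    - \sum_i z i <= sigma.
  move=> [s0 [t /(cover _ _ s0) H]].
  by rewrite lerNl -(sum_bound sigma t); apply: ler_sum => i _.
pose t0 := \sum_i z i *: omega i.
(* If [- sum_i z_i <= 0], then [L_i x = z_i] for all [x] in [Xi] and all i, so
   [Xi] has at most one point. *)
have s0 : 0 < - \sum_i z i.
  rewrite ltNge; apply/negP => sz.
  have Xt0 x : Xi x -> x = t0.
    move=> Xx; rewrite -(bary_lin_vertices omega_indep x).
    apply: eq_bigr => i _; congr (_ *: _); apply/eqP; rewrite -subr_eq0.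
    have d0 j : true -> 0 <= bary_lin omega j x - z j.
      by move=> _; rewrite subr_ge0 z_le.
    have : \sum_j (bary_lin omega j x - z j) == 0.
      rewrite eq_le sumr_ge0 ?andbT; last exact: d0.
      by rewrite sumrB sum_bary_lin// sub0r.
    by rewrite psumr_eq0// => /allP/(_ i (mem_index_enum _)).
  by move: pq; rewrite (Xt0 p Xp) (Xt0 q Xq) eqxx.
(* By [bary_lin_comb], this factor and [t0] turn each of the covering inequalities into an
   equality. *)
have Xs0 : Xi `<=` scale_translate (- \sum_i z i) t0 (conv_hull omega).
  by apply/cover => // i; rewrite bary_lin_comb// mulNr opprK subrK.
have min0 : is_minimum (covering_factors (conv_hull omega) Xi) (- \sum_i z i).
  by split => //; split => //; exists t0.
exists z; split=> //; split; first by exists (- \sum_i z i), t0.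
move=> sigma t [sC smin] XS.
have sE : sigma = - \sum_i z i.
  by apply/eqP; rewrite eq_le smin ?lb//; exact: min0.1.
split=> //; have /(cover _ _ sC.1) H := XS.
(* The slacks in the covering inequalities are nonnegative and sum to [\sum_i z i + sigma = 0], so
   each is zero. *)
have zE i : z i = bary_lin omega i t - sigma * bary_const omega i.
  have d0 j : true -> 0 <= z j -
      (bary_lin omega j t - sigma * bary_const omega j).
    by move=> _; rewrite subr_ge0.
  have : \sum_j (z j - (bary_lin omega j t - sigma * bary_const omega j)) == 0.
    by rewrite sumrB sum_bound sE opprK subrr.
  rewrite psumr_eq0// => /allP/(_ i (mem_index_enum _)).
  by rewrite implyTb subr_eq0 => /eqP.
under eq_bigr do rewrite zE scalerBl -scalerA.
rewrite sumrB bary_lin_vertices// -scaler_sumr.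
by rewrite bary_const_vertices// scaler0 subr0.
Qed.
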